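(* Let $(M,\langle\,,\rangle)$ be a connected Riemannian manifold of dimension $m\ge 2$, let $T$ be a symmetric positive semi-definite $(2,0)$-tensor field on $M$, $X$ a vector field on $M$, and let $L=L_{T,X}$ be the operator $$Lu=\operatorname{div}\big(T(\nabla u,\cdot)^\sharp\big)-\langle X,\nabla u\rangle ,\qquad u\in\mathcal C^2(M).$$ Let $q\in\mathcal C^0(M)$, $q\ge 0$, be such that $q(x)>0$ outside a compact set. Let $\gamma\in\mathcal C^2(M)$ be such that (i) $\gamma(x)\to+\infty$ as $x\to\infty$, (ii) $q(x)L\gamma(x)\le B$ outside a compact set, for some constant $B>0$. If $u\in\mathcal C^2(M)$ and $u^*=\sup_M u<+\infty$, then there exists a sequence $\{x_k\}\subset M$ such that for each $k\in\mathbb N$ ($k\ge1$) $$\text{a) } u(x_k)>u^*-\frac1k,\qquad \text{b) } q(x_k)Lu(x_k)<\frac1k .$$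
   Context: $M$ is not assumed to be (geodesically) complete. $T$ is viewed as a field of symmetric bilinear forms on tangent spaces, regular enough that $\operatorname{div}T$ is defined; $\sharp:T^*M\to TM$ is the musical isomorphism. Equivalently, $Lu=\operatorname{tr}(T\circ\operatorname{Hess}(u))+(\operatorname{div}T)(\nabla u)-\langle X,\nabla u\rangle$, where $\operatorname{div}T$ is the 1-form obtained by tracing $\nabla T$. ''As $x\to\infty$'' means as $x$ leaves every compact subset of $M$. *)

(* Defs.v *)
(* MathComp / MathComp-Analysis; the reals are an arbitrary R : realType. *)
From HB Require Import structures.
From mathcomp Require Import all_boot all_order all_algebra.
From mathcomp Require Import all_classical all_reals all_analysis.

Set Implicit Arguments.
Unset Strict Implicit.
Unset Printing Implicit Defensive.

Import Order.TTheory GRing.Theory Num.Theory.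
Import numFieldNormedType.Exports.

Local Open Scope classical_set_scope.
Local Open Scope ring_scope.

(* The filter of "x -> oo": it is generated by the complements of the compact
   sets, hence improper exactly when T is compact. *)
Definition at_infinity (T : topologicalType) : set_system T :=
  filter_from [set K : set T | compact K] (@setC T).
Arguments at_infinity : clear implicits.

Global Instance at_infinity_filter (T : topologicalType) :
  Filter (at_infinity T).
Proof.
apply: filter_from_filter; first by exists set0; exact: compact0.
move=> K L cK cL; exists (K `|` L); first exact: compactU.
by rewrite setCU.
Qed.

(* f is of class C^k on the open set U of R^m. *)
Fixpoint Ck (R : realType) (m k : nat) (U : set 'rV[R]_m) (f : 'rV[R]_m -> R)
    : Prop :=
  match k with
  | 0 => forall y, U y -> {for y, continuous f}
  | k'.+1 => (forall y, U y -> differentiable f y) /\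
             (forall i : 'I_m, Ck k' U (fun y => 'D_(delta_mx 0 i) f y))
  end.

Record chart (R : realType) (m : nat) (T : topologicalType) := Chart {
  dom : set T;
  img : set 'rV[R]_m;
  coord : T -> 'rV[R]_m;
  param : 'rV[R]_m -> T;
  dom_open : open dom;
  img_open : open img;
  coord_img : forall x, dom x -> img (coord x);
  param_dom : forall y, img y -> dom (param y);
  coordK : forall x, dom x -> param (coord x) = x;
  paramK : forall y, img y -> coord (param y) = y;
  coord_continuous : forall x, dom x -> {for x, continuous coord};
  param_continuous : forall y, img y -> {for y, continuous param}
}.

Definition transition (R : realType) (m : nat) (T : topologicalType)
    (c d : chart R m T) : 'rV[R]_m -> 'rV[R]_m :=
  coord d \o param c.

(* Smooth manifolds without boundary; the atlas need not be maximal. *)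
Record manifold (R : realType) (m : nat) := Manifold {
  points :> topologicalType;
  atlas : set (chart R m points);
  hausdorff : hausdorff_space points;
  countable_basis : @second_countable points;
  atlas_cover : forall x : points, exists2 c, atlas c & dom c x;
  atlas_smooth : forall c d, atlas c -> atlas d -> forall (k : nat) (j : 'I_m),
    Ck k (coord c @` (dom c `&` dom d)) (fun y => transition c d y 0 j)
}.

Section Fields.
Context (R : realType) (m : nat) (M : manifold R m).

Definition chart_at (x : M) : chart R m M :=
  projT1 (cid2 (atlas_cover x)).

Definition classC (k : nat) (f : M -> R) : Prop :=
  forall c, atlas c -> Ck k (img c) (f \o param c).

(* (∂f/∂x^i)(x), where (x^1, ..., x^m) are the coordinates of the chart c. *)
Definition pd (c : chart R m M) (f : M -> R) (i : 'I_m) (x : M) : R :=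
  'D_(delta_mx 0 i) (f \o param c) (coord c x).

(* Jacobian of the change of coordinates from c to d; as 'J is made for row
   vectors, its entry (i, j) is ∂(x_d)^j / ∂(x_c)^i. *)
Definition jac (c d : chart R m M) (x : M) : 'M[R]_m :=
  'J (transition c d) (coord c x).

(* Tensor fields are given classically, by their components in each chart of
   the atlas and the law relating the components in two charts; values at
   points outside the domain of the chart are irrelevant. *)
Record vector_field := VectorField {
  vf_comp :> chart R m M -> M -> 'rV[R]_m;
  vf_law : forall c d x, atlas c -> atlas d -> dom c x -> dom d x ->
    vf_comp d x = vf_comp c x *m jac c d x
}.

Record bilinear_field := BilinearField {
  bf_comp :> chart R m M -> M -> 'M[R]_m;
  bf_law : forall c d x, atlas c -> atlas d -> dom c x -> dom d x ->
    bf_comp c x = jac c d x *m bf_comp d x *m (jac c d x)^T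
}.

Definition bilin (A : 'M[R]_m) (v w : 'rV[R]_m) : R := (v *m A *m w^T) 0 0.

Definition symmetric_field (T : bilinear_field) : Prop :=
  forall c x, atlas c -> dom c x -> forall v w,
    bilin (T c x) v w = bilin (T c x) w v.

Definition psd_field (T : bilinear_field) : Prop :=
  forall c x, atlas c -> dom c x -> forall v, 0 <= bilin (T c x) v v.

Definition posdef_field (T : bilinear_field) : Prop :=
  forall c x, atlas c -> dom c x -> forall v, v != 0 -> 0 < bilin (T c x) v v.

Definition smooth_field (T : bilinear_field) : Prop :=
  forall c, atlas c -> forall (k : nat) (i j : 'I_m),
    Ck k (img c) (fun y => T c (param c y) i j).

(* The regularity under which the first derivatives of T, hence div T, make
   sense. *)
Definition differentiable_field (T : bilinear_field) : Prop :=
  forall c, atlas c -> forall y, img c y -> forall i j : 'I_m,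
    differentiable (fun z => T c (param c z) i j) y.

Record riemannian_metric := RiemannianMetric {
  metric :> bilinear_field;
  metric_sym : symmetric_field metric;
  metric_posdef : posdef_field metric;
  metric_smooth : smooth_field metric
}.

End Fields.

Section Operator.
Context (R : realType) (m : nat) (M : manifold R m) (g : riemannian_metric M).

(* Below, vector fields and 1-forms defined near a point are represented by
   the rows of their components in a fixed chart c. *)

Definition differential (c : chart R m M) (u : M -> R) (x : M) : 'rV[R]_m :=
  \row_i pd c u i x.

Definition sharp (c : chart R m M) (w : M -> 'rV[R]_m) (x : M) : 'rV[R]_m :=
  w x *m invmx (g c x).

Definition gradient (c : chart R m M) (u : M -> R) : M -> 'rV[R]_m :=
  sharp c (differential c u).

(* The 1-form T(Y, .). *)
Definition contract (T : bilinear_field M) (c : chart R m M)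
    (Y : M -> 'rV[R]_m) (x : M) : 'rV[R]_m :=
  Y x *m T c x.

(* Christoffel symbol Γ^k_{ij} of the Levi-Civita connection. *)
Definition christoffel (c : chart R m M) (k i j : 'I_m) (x : M) : R :=
  2^-1 * \sum_(l < m) invmx (g c x) k l *
    (pd c (fun z => g c z j l) i x + pd c (fun z => g c z i l) j x
     - pd c (fun z => g c z i j) l x).

(* Component k of the covariant derivative of Y along ∂/∂x^i. *)
Definition covariant_derivative (c : chart R m M) (Y : M -> 'rV[R]_m)
    (i k : 'I_m) (x : M) : R :=
  pd c (fun z => Y z 0 k) i x + \sum_(j < m) christoffel c k i j x * Y x 0 j.

Definition divergence (c : chart R m M) (Y : M -> 'rV[R]_m) (x : M) : R :=
  \sum_(i < m) covariant_derivative c Y i i x.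

(* L_{T,X} u (x) = div (T(∇u, .)^#) - <X, ∇u>, computed in a chart around x;
   for u of class C^2 and T differentiable, the value does not depend on which
   chart of the atlas is taken. *)
Definition operatorL (T : bilinear_field M) (X : vector_field M)
    (u : M -> R) (x : M) : R :=
  let c := chart_at x in
  divergence c (sharp c (contract T c (gradient c u))) x
  - bilin (g c x) (X c x) (gradient c u x).

End Operator.

(* Main.v *)
(* If u attains its supremum, L u <= 0 at a maximum point, as T is positive
   semi-definite.  Otherwise the maximum of u over the compact set K outside of
   which q L gamma <= B is less than u^*.  Since gamma is an exhaustion, for
   a > 0 the function u - a gamma has a maximum point x, where
   L u <= a L gamma.  When a is small, u x exceeds both u^* - 1/k and the
   maximum of u over K; hence x is outside K and q L u <= a B < 1/k there. *)
Require Import Defs.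
From HB Require Import structures.
From mathcomp Require Import all_boot all_order all_algebra.
From mathcomp Require Import all_classical all_reals all_analysis.
From mathcomp Require Import ring lra.

Import Order.TTheory GRing.Theory Num.Theory.
Import numFieldNormedType.Exports.

Local Open Scope classical_set_scope.
Local Open Scope ring_scope.

(** * Derivatives along lines and of inverse matrices; derivative tests at a maximum *)

Section Calculus.
Context {R : realType}.

Lemma is_derive_line {V : normedModType R} (f : V -> R) (x v : V) (t d : R) :
  is_derive (t *: v + x) v f d -> is_derive t 1 (fun s => f (s *: v + x)) d.
Proof.
have E : (fun h : R => h^-1 *: (f ((h *: 1 + t) *: v + x) - f (t *: v + x))) =
    (fun h : R => h^-1 *: (f (h *: v + (t *: v + x)) - f (t *: v + x))).
  by apply/funext => h; rewrite [h *: 1]mulr1 scalerDl addrA.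
case=> df <-; split; first by move: df; rewrite /derivable /= -E.
by rewrite /derive /= -E.
Qed.

(** A positive [d] would make [df], which vanishes at 0, positive just to the right of 0, and [f]
    would increase there by the mean value theorem. So [df] needs a derivative at 0 only. *)
Lemma second_derivative_at_max (f df : R -> R) (d : R) :
  (\forall t \near 0, is_derive (t : R) 1 f (df t)) -> is_derive (0 : R) 1 df d ->
  (forall t, f t <= f 0) -> d <= 0.
Proof.
move=> fdf dfd fmax; rewrite leNgt; apply/negP => d0.
have [e /= e0 he] := (nbhs_ballP _ _).1 fdf.
have df0 : df 0 = 0.
  have [_ <-] := he 0 (ballxx _ e0).
  have [] // := @derive1_at_max R f (- e) e 0.
  - by rewrite ge0_cp// ltW.
  - move=> t te; have [] // := he t.
    by rewrite /ball/= sub0r normrN ltr_norml; rewrite in_itv in te.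
  - by rewrite in_itv/= oppr_lt0 e0.
have cvg : h^-1 *: (df (h *: 1 + 0) - df 0) @[h --> 0^'] --> d.
  by have [dfd0 <-] := dfd; rewrite /derive/=; exact: dfd0.
have : \forall h \near 0^', 0 < h^-1 *: (df (h *: 1 + 0) - df 0).
  exact: cvgr_gt cvg _ d0.
move=> /nbhs_ballP[r /= r0 hr].
(* Strictly inside both the ball where [f] is derivable and the one where the difference quotient of
   [df] is positive. *)
pose s := Num.min e r / 2.
have m0 : 0 < Num.min e r by rewrite lt_min e0 r0.
have s0 : 0 < s by rewrite divr_gt0.
have sm : s < Num.min e r by rewrite ltr_pdivrMr// ltr_pMr// ltr1n.
move: (sm); rewrite lt_min => /andP[se sr].
have fs c : 0 <= c -> c <= s -> is_derive c 1 f (df c).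
  move=> c0 cs; apply: he.
  by rewrite /ball/= sub0r normrN ger0_norm// (le_lt_trans cs).
have [||c cs] := @MVT R f df 0 s s0.
- move=> t; rewrite in_itv/= => /andP[t0 ts].
  by apply: fs; exact: ltW.
- apply: derivable_within_continuous => t; rewrite in_itv/= => /andP[t0 ts].
  by have [] := fs t t0 ts.
- move: cs; rewrite in_itv/= => /andP[c0 cs] fsE.
  have : 0 < c^-1 *: (df (c *: 1 + 0) - df 0).
    apply: hr; last by rewrite /= gt_eqF.
    by rewrite /ball/= sub0r normrN gtr0_norm// (lt_trans cs).
  rewrite [c *: 1]mulr1 addr0 df0 subr0 pmulr_rgt0 ?invr_gt0// => dc.
  by have := fmax s; rewrite leNgt -subr_gt0 fsE mulr_gt0// subr0.
Qed.

Lemma derive_coordE {m} (f : 'rV[R]_m -> R) (x v : 'rV[R]_m) :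
  differentiable f x ->
  'D_v f x = \sum_(j < m) v 0 j * 'D_(delta_mx 0 j) f x.
Proof.
move=> df; rewrite deriveE// [in LHS](row_sum_delta v) linear_sum.
by apply: eq_bigr => j _; rewrite linearZ/= deriveE.
Qed.

Lemma is_derive_sumf {V : normedModType R} n (h : 'I_n -> V -> R) (x v : V)
    (dh : 'I_n -> R) : (forall i, is_derive x v (h i) (dh i)) ->
  is_derive x v (fun y => \sum_(i < n) h i y) (\sum_(i < n) dh i).
Proof. by move=> hh; rewrite -fct_sumE; exact: is_derive_sum. Qed.

Lemma derivable_bigsum {V : normedModType R} (I : Type) (r : seq I)
    (h : I -> V -> R) (x v : V) : (forall i, derivable (h i) x v) ->
  derivable (fun y => \sum_(i <- r) h i y) x v.
Proof.
move=> hh; rewrite -fct_sumE.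
elim: r => [|i r IH]; first by rewrite big_nil; exact: derivable_cst.
by rewrite big_cons; exact: derivableD.
Qed.

Lemma derivable_bigprod {V : normedModType R} (I : Type) (r : seq I)
    (h : I -> V -> R) (x v : V) : (forall i, derivable (h i) x v) ->
  derivable (fun y => \prod_(i <- r) h i y) x v.
Proof.
move=> hh; elim: r => [|i r IH].
  by under eq_fun do rewrite big_nil; exact: derivable_cst.
by under eq_fun do rewrite big_cons; exact: derivableM.
Qed.

Lemma derivable_det {V : normedModType R} n (M : V -> 'M[R]_n) (x v : V) :
  (forall i j, derivable (fun y => M y i j) x v) ->
  derivable (fun y => \det (M y)) x v.
Proof.
move=> dM; apply: derivable_bigsum => s.
apply: derivableZ.
by apply: derivable_bigprod => i.
Qed.

Lemma derivable_mulmx {V : normedModType R} p n k (M : V -> 'M[R]_(p, n))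
    (N : V -> 'M[R]_(n, k)) (x v : V) :
  (forall i j, derivable (fun y => M y i j) x v) ->
  (forall i j, derivable (fun y => N y i j) x v) ->
  forall i j, derivable (fun y => (M y *m N y) i j) x v.
Proof.
move=> dM dN i j; under eq_fun do rewrite mxE.
by apply: derivable_bigsum => l; exact: derivableM.
Qed.

(** Cramer's rule. Invertibility is asked near [x] because [invmx] returns a singular matrix
    unchanged. *)
Lemma derivable_invmx {V : normedModType R} n (M : V -> 'M[R]_n) (x v : V) :
  (\forall y \near x, M y \in unitmx) ->
  (forall i j, derivable (fun y => M y i j) x v) ->
  forall i j, derivable (fun y => invmx (M y) i j) x v.
Proof.
move=> uM dM i j.
apply: (@near_eq_derivable _ _ _ (fun y => (\det (M y))^-1 * cofactor (M y) j i)).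
  by apply: filterS uM => y uMy; rewrite /invmx uMy !mxE.
have detx : \det (M x) != 0 by have := nbhs_singleton uM; rewrite unitmxE unitfE.
apply: derivableM; first by apply: derivableV => //; exact: derivable_det.
rewrite /cofactor; apply: derivableZ.
by apply: derivable_det => i' j'; under eq_fun do rewrite !mxE; exact: dM.
Qed.

Lemma is_derive_line_near {V : normedModType R} (f : V -> R) (x v : V) :
  (\forall y \near x, differentiable f y) ->
  \forall t \near 0,
    is_derive (t : R) 1 (fun s => f (s *: v + x)) ('D_v f (t *: v + x)).
Proof.
move=> df.
have cl : {for 0, continuous (fun t : R => t *: v + x)}.
  apply: cvgD; last exact: cvg_cst.
  exact: scalel_continuous.
have : \forall t \near (0 : R), differentiable f (t *: v + x).
  by rewrite -(_ : 0 *: v + x = x) in df; [exact: cl df|rewrite scale0r add0r].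
apply: filterS => t dft; apply: is_derive_line; apply: derivableP.
exact: diff_derivable.
Qed.

Lemma derive_at_max {V : normedModType R} (f : V -> R) (x v : V) :
  (\forall y \near x, differentiable f y) -> (forall y, f y <= f x) ->
  'D_v f x = 0.
Proof.
move=> /(@is_derive_line_near _ _ _ v) dl fmax.
have [e /= e0 he] := (nbhs_ballP _ _).1 dl.
have [] := he 0 (ballxx _ e0); rewrite scale0r add0r => _ <-.
have [] // := @derive1_at_max R (fun s => f (s *: v + x)) (- e) e 0.
- by rewrite ge0_cp// ltW.
- move=> t te; have [] // := he t.
  by rewrite /ball/= sub0r normrN ltr_norml; rewrite in_itv in te.
- by rewrite in_itv/= oppr_lt0 e0.
- by move=> t _; rewrite scale0r add0r.
Qed.

(* The gradient is handed over as a family [p] of differentiable functions that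
   agrees with it only near x: differentiability at a point is awkward to
   transport along an equality of germs, whereas derivatives along lines are
   not. *)
Lemma hessian_at_max {m} (f : 'rV[R]_m -> R) (p : 'I_m -> 'rV[R]_m -> R)
    (x v : 'rV[R]_m) :
  (\forall y \near x, differentiable f y) ->
  (\forall y \near x, forall j, 'D_(delta_mx 0 j) f y = p j y) ->
  (forall j, differentiable (p j) x) ->
  (forall y, f y <= f x) ->
  \sum_(i < m) \sum_(j < m) v 0 i * v 0 j * 'D_(delta_mx 0 i) (p j) x <= 0.
Proof.
move=> df fp dp fmax.
have line0 : 0 *: v + x = x by rewrite scale0r add0r.
apply: (@second_derivative_at_max (fun t => f (t *: v + x))
  (fun t => 'D_v f (t *: v + x))).
- exact: is_derive_line_near.
- apply: (@is_derive_line _ ('D_v f)); rewrite line0.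
  apply: (@near_eq_is_derive _ _ _ (fun y => \sum_(j < m) v 0 j * p j y)).
    apply: filterS2 df fp => y dfy fpy.
    by rewrite derive_coordE//; apply: eq_bigr => j _; rewrite fpy.
  rewrite exchange_big/=; apply: is_derive_sumf => j.
  apply: is_derive_eq.
    apply: (@is_deriveZ _ _ _ _ (v 0 j)).
    by apply: derivableP; exact: diff_derivable.
  rewrite derive_coordE// scaler_sumr; apply: eq_bigr => i _.
  by rewrite -mulrA mulrCA.
- by move=> t; rewrite line0.
Qed.

End Calculus.

(** * Traces of products of semi-definite matrices *)

Section PositiveSemidefinite.
Context {R : realType}.

Definition psdmx {n} (A : 'M[R]_n) : Prop :=
  A^T = A /\ forall v : 'rV[R]_n, 0 <= bilin A v v.

Lemma bilin_sum {n} (A : 'M[R]_n) (v w : 'rV[R]_n) :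
  bilin A v w = \sum_(i < n) \sum_(j < n) v 0 i * w 0 j * A i j.
Proof.
rewrite /bilin mxE exchange_big/=; apply: eq_bigr => j _.
rewrite !mxE mulr_suml; apply: eq_bigr => i _.
by rewrite mulrAC.
Qed.

Lemma bilin_delta {n} (A : 'M[R]_n) i j :
  bilin A (delta_mx 0 i) (delta_mx 0 j) = A i j.
Proof. by rewrite /bilin -rowE trmx_delta -colE !mxE. Qed.

Lemma bilinDl {n} (A : 'M[R]_n) a v v' w :
  bilin A (v + a *: v') w = bilin A v w + a * bilin A v' w.
Proof. by rewrite /bilin !mulmxDl -!scalemxAl !mxE. Qed.

Lemma bilinDr {n} (A : 'M[R]_n) a v w w' :
  bilin A v (w + a *: w') = bilin A v w + a * bilin A v w'.
Proof. by rewrite /bilin linearD linearZ/= !mulmxDr -!scalemxAr !mxE. Qed.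

Lemma psdmx_diag_ge0 {n} (A : 'M[R]_n) i : psdmx A -> 0 <= A i i.
Proof. by move=> [_ /(_ (delta_mx 0 i))]; rewrite bilin_delta. Qed.

(** This is the quadratic form at [v + a *: delta_mx 0 i], as a polynomial in [a]; well-chosen
    values of [a] give the facts below on zero diagonal entries and Schur complements. *)
Lemma psdmx_expand {n} (A : 'M[R]_n) (a : R) v i (psdA : psdmx A) :
  0 <= bilin A v v + 2 * a * (v *m A) 0 i + a ^+ 2 * A i i.
Proof.
have [AT A_ge0] := psdA; have := A_ge0 (v + a *: delta_mx 0 i).
rewrite bilinDl !bilinDr bilin_delta.
have -> : bilin A v (delta_mx 0 i) = (v *m A) 0 i.
  by rewrite /bilin trmx_delta -colE mxE.
have -> : bilin A (delta_mx 0 i) v = (v *m A) 0 i.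
  rewrite /bilin -rowE -{2}AT -[v in RHS]trmxK -trmx_mul !mxE.
  by apply: eq_bigr => j _; rewrite !mxE.
by rewrite (_ : _ + _ + _ =
  bilin A v v + 2 * a * (v *m A) 0 i + a ^+ 2 * A i i)//; ring.
Qed.

Lemma psdmx_row0 {n} (A : 'M[R]_n) i j : psdmx A -> A i i = 0 -> A j i = 0.
Proof.
move=> psdA Aii; apply/eqP/negPn/negP => Aji.
(* As [A i i = 0], the polynomial is affine in [a]; this [a] gives it the value -1. *)
have := psdmx_expand _ (- (A j j + 1) / (2 * A j i)) (delta_mx 0 j) i psdA.
rewrite bilin_delta -rowE mxE Aii mulr0 addr0.
rewrite (_ : _ + _ = -1) ?oppr_ge0 ?ler10//.
by field.
Qed.

(** The Schur complement of the pivot [A i i], kept at size [n] so that an induction can stay within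
    one matrix type. *)
Definition schur {n} (A : 'M[R]_n) (i : 'I_n) : 'M[R]_n :=
  \matrix_(j, k) (A j k - A j i * A k i / A i i).

Lemma psdmx_schur {n} (A : 'M[R]_n) i : psdmx A -> A i i != 0 ->
  psdmx (schur A i).
Proof.
move=> psdA Aii; have [AT _] := psdA; split.
  have Asym j k : A j k = A k j by rewrite -{1}AT mxE.
  by apply/matrixP => j k; rewrite !mxE Asym (mulrC (A k i)).
(* This [a] minimises the polynomial; the minimum is the Schur form at [v]. *)
move=> v; have := psdmx_expand _ (- (v *m A) 0 i / A i i) v i psdA.
rewrite (_ : _ + _ + _ = bilin (schur A i) v v)//.
have -> : bilin (schur A i) v v = bilin A v v - ((v *m A) 0 i) ^+ 2 / A i i.
  rewrite !bilin_sum expr2 mxE mulr_suml mulr_suml -sumrB.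
  apply: eq_bigr => j _.
  rewrite mulr_sumr mulr_suml -sumrB; apply: eq_bigr => k _.
  by rewrite mxE; field.
by field.
Qed.

(* Subtracting the rank-one matrix (A e_i)(A e_i)^T / A_ii clears the i-th row
   and column of A, keeps it positive semi-definite, and changes the sum by a
   value of the quadratic form of H. *)
Lemma sum_psdmx_le0 {n} (H A : 'M[R]_n) :
  (forall v : 'rV[R]_n, bilin H v v <= 0) -> psdmx A ->
  \sum_(i < n) \sum_(j < n) H i j * A j i <= 0.
Proof.
move=> H_le0.
(* Induction on the number of nonzero diagonal entries; if there are none, [A] is zero. *)
have [k] := ubnP #|[pred i | A i i != 0]|; elim: k A => // k IH A cardA psdA.
have [i Aii|A0] := pickP (fun i => A i i != 0); last first.
  rewrite big1// => i _; rewrite big1// => j _.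
  by rewrite (psdmx_row0 _ _ _ psdA) ?mulr0//; apply/eqP/negbFE; exact: A0.
have Aii0 : 0 < A i i by rewrite lt_neqAle eq_sym Aii psdmx_diag_ge0.
have : \sum_(j < n) \sum_(l < n) H j l * schur A i l j <= 0.
  apply: IH; last exact: psdmx_schur.
  rewrite -ltnS; apply: leq_trans cardA; rewrite ltnS; apply: proper_card.
  apply/properP; split.
    (* [A j j = 0] forces [A j i = 0], so zero diagonal entries stay zero, while the pivot becomes
       zero. *)
    apply/fintype.subsetP => j; rewrite !inE !mxE; apply: contraNneq => Ajj.
    have Aji : A j i = 0 by rewrite -(psdA.1) mxE (psdmx_row0 _ _ _ psdA Ajj).
    by rewrite Ajj Aji !mul0r subr0.
  by exists i; rewrite !inE ?mxE ?Aii// negbK mulfK ?subrr.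
suff -> : \sum_(j < n) \sum_(l < n) H j l * schur A i l j =
    \sum_(j < n) \sum_(l < n) H j l * A l j
    - bilin H (row i A^T) (row i A^T) / A i i.
  rewrite lerBlDr add0r => /le_trans; apply.
  by rewrite ler_pdivrMr// mul0r.
rewrite bilin_sum mulr_suml -sumrB; apply: eq_bigr => j _.
rewrite mulr_suml -sumrB; apply: eq_bigr => l _.
by rewrite !mxE; field.
Qed.

End PositiveSemidefinite.

(** * The operator in coordinates and its comparison at a maximum *)

Section LocalExpression.
Context {R : realType} {m : nat} {M : manifold R m}.
Context (g : riemannian_metric M).
Implicit Types (c : chart R m M) (u : M -> R).

Lemma chart_atP (x : M) : atlas (chart_at x) /\ dom (chart_at x) x.
Proof. by rewrite /chart_at; case: cid2. Qed.

Lemma nbhs_img c (y : 'rV[R]_m) : img c y -> nbhs y (img c).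
Proof. by move=> iy; apply: open_nbhs_nbhs; split=> //; exact: img_open. Qed.

Lemma symmetric_field_tr (T : bilinear_field M) c (x : M) :
  symmetric_field T -> atlas c -> dom c x -> (T c x)^T = T c x.
Proof.
move=> symT ac dx; apply/matrixP => i j.
by rewrite mxE -!bilin_delta symT.
Qed.

Lemma metric_unitmx c (x : M) : atlas c -> dom c x -> g c x \in unitmx.
Proof.
move=> ac dx; rewrite unitmxE unitfE; apply/negP => /det0P[v v0 vG].
have := metric_posdef g ac dx v0.
by rewrite /bilin vG mul0mx mxE ltxx.
Qed.

(* In the chart c, the vector field T(∇u, .)^# is the row of partial derivatives
   of u times this matrix. *)
Definition principal (T : bilinear_field M) c (x : M) : 'M[R]_m :=
  invmx (g c x) *m T c x *m invmx (g c x).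

(** A congruence by the symmetric matrix [invmx (g c x)]: the form at [v] is that of [T] at
    [v *m invmx (g c x)]. *)
Lemma principal_psdmx (T : bilinear_field M) c (x : M) :
  symmetric_field T -> psd_field T -> atlas c -> dom c x ->
  psdmx (principal T c x).
Proof.
move=> symT psdT ac dx.
have invGT : (invmx (g c x))^T = invmx (g c x).
  by rewrite trmx_inv (symmetric_field_tr _ _ _ (Defs.metric_sym g) ac dx).
split; first by rewrite !trmx_mul invGT (symmetric_field_tr _ _ _ symT ac dx) mulmxA.
move=> v; have := psdT c x ac dx (v *m invmx (g c x)).
by rewrite /bilin /principal trmx_mul invGT !mulmxA.
Qed.

Lemma derivable_principal (T : bilinear_field M) c (y v : 'rV[R]_m) i j :
  differentiable_field T -> atlas c -> img c y ->
  derivable (fun z => principal T c (param c z) i j) y v.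
Proof.
move=> dT ac iy.
have dinvG k l : derivable (fun z => invmx (g c (param c z)) k l) y v.
  apply: derivable_invmx => [|k' l'].
    by apply: filterS (nbhs_img c y iy) => z iz; apply: metric_unitmx => //; exact: param_dom.
  by have [dg _] := metric_smooth g ac 1 k' l'; exact/diff_derivable/dg.
apply: derivable_mulmx => // k l.
by apply: derivable_mulmx => // k' l'; exact/diff_derivable/dT.
Qed.

(** The Hessian is the plain coordinate one; the Christoffel terms are of first order in [f] and are
    kept apart. *)
Definition second_order (A : 'M[R]_m) (f : 'rV[R]_m -> R) (y : 'rV[R]_m) : R :=
  \sum_(i < m) \sum_(j < m)
    'D_(delta_mx 0 i) ('D_(delta_mx 0 j) f) y * A j i.

(* The coefficients of the first-order part F never matter: at a maximum of
   u - a gamma, where du = a dgamma, only its homogeneity is needed. *)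
Lemma operatorLE (T : bilinear_field M) (X : vector_field M) (x : M) :
  differentiable_field T ->
  exists F : 'rV[R]_m -> R, (forall a v, F (a *: v) = a * F v) /\
  forall u, classC 2 u ->
    let c := chart_at x in
    operatorL g T X u x =
      second_order (principal T c x) (u \o param c) (Defs.coord c x)
      + F (differential c u x).
Proof.
move=> dT; set c := chart_at x.
have [ac dx] : atlas c /\ dom c x := chart_atP x.
pose y := Defs.coord c x.
have iy : img c y by exact: coord_img.
have ny : nbhs y (img c) := nbhs_img c y iy.
pose A z := principal T c (param c z).
(* The terms come from differentiating the principal matrix, from the Christoffel symbols of the
   divergence, and from [X]. *)
exists (fun v : 'rV[R]_m => \sum_(i < m)
  (\sum_(j < m) v 0 j * 'D_(delta_mx 0 i) (fun z => A z j i) y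
   + \sum_(j < m) christoffel g c i i j x * (v *m principal T c x) 0 j)
  - bilin (g c x) (X c x) (v *m invmx (g c x))).
split=> [a v|u uC2].
  rewrite mulrBr; congr (_ - _); last first.
    by rewrite /bilin -scalemxAl linearZ/= -scalemxAr mxE.
  rewrite mulr_sumr; apply: eq_bigr => i _; rewrite mulrDr !mulr_sumr.
  congr (_ + _); apply: eq_bigr => j _; first by rewrite mxE mulrA.
  by rewrite -scalemxAl mxE mulrCA.
have [du ddu] := uC2 c ac.
have pdE z j : img c z ->
    pd c u j (param c z) = 'D_(delta_mx 0 j) (u \o param c) z.
  by move=> iz; rewrite /pd paramK.
rewrite /operatorL -/c addrA; congr (_ - _).
rewrite /divergence /covariant_derivative /second_order -big_split/=.
apply: eq_bigr => i _; rewrite addrA; congr (_ + _); last first.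
  by apply: eq_bigr => j _; rewrite /sharp /contract /gradient /sharp !mulmxA.
rewrite /pd -/y.
(* The two functions agree on [img c], where [paramK] holds, hence near [y]. *)
transitivity ('D_(delta_mx 0 i) (fun z => \sum_(j < m)
    'D_(delta_mx 0 j) (u \o param c) z * A z j i) y).
  apply: near_eq_derive; apply: filterS ny => z iz.
  rewrite /= /sharp /contract /gradient /sharp -!mulmxA mxE.
  by apply: eq_bigr => j _; rewrite mxE pdE// /A /principal !mulmxA.
have dA j : derivable (fun z => A z j i) y (delta_mx 0 i).
  exact: derivable_principal.
have -> : principal T c x = A y by rewrite /A /y coordK.
rewrite -big_split/=.
have := @is_derive_sumf R _ m
  (fun j z => 'D_(delta_mx 0 j) (u \o param c) z * A z j i) y (delta_mx 0 i)
  (fun j => 'D_(delta_mx 0 i) ('D_(delta_mx 0 j) (u \o param c)) y * A y j i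
    + differential c u x 0 j * 'D_(delta_mx 0 i) (fun z => A z j i) y).
case=> // j; apply: is_derive_eq.
  apply: is_deriveM; apply: derivableP => //.
  by apply: diff_derivable; have [dDu _] := ddu j; exact: dDu.
by rewrite [differential c u x 0 j]mxE addrC; congr (_ + _); exact: mulrC.
Qed.

(** At [x] the differentials of [u] and [a * gamma] coincide, so the first-order parts cancel; what
    remains is the trace of a negative semi-definite Hessian times a positive semi-definite
    matrix. *)
Lemma operatorL_at_max (T : bilinear_field M) (X : vector_field M)
    (u gamma : M -> R) (a : R) (x : M) :
  symmetric_field T -> psd_field T -> differentiable_field T ->
  classC 2 u -> classC 2 gamma ->
  (forall y, u y - a * gamma y <= u x - a * gamma x) ->
  operatorL g T X u x <= a * operatorL g T X gamma x.
Proof.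
move=> symT psdT dT uC2 gC2 xmax.
have [F [FZ LE]] := operatorLE T X x dT.
rewrite (LE _ uC2) (LE _ gC2) /=; set c := chart_at x.
have [ac dx] : atlas c /\ dom c x := chart_atP x.
pose y := Defs.coord c x.
have iy : img c y by exact: coord_img.
have ny : nbhs y (img c) := nbhs_img c y iy.
have [du ddu] := uC2 c ac; have [dg ddg] := gC2 c ac.
pose U := u \o param c; pose G := gamma \o param c; pose W := U - a *: G.
(* Valid even for [z] outside [img c]: [param c] is total and the maximum at [x] is over all of
   [M]. *)
have Wmax z : W z <= W y.
  have -> : W y = u x - a * gamma x.
    by rewrite -[LHS]/(u (param c y) - a * gamma (param c y)) coordK.
  exact: xmax (param c z).
have dW : \forall z \near y, differentiable W z.
  apply: filterS ny => z iz.
  by apply: differentiableB; [exact: du|apply: differentiableZ; exact: dg].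
have DW j z : img c z -> 'D_(delta_mx 0 j) W z =
    'D_(delta_mx 0 j) U z - a * 'D_(delta_mx 0 j) G z.
  move=> iz.
  have dUz : derivable U z (delta_mx 0 j) by apply: diff_derivable; exact: du.
  have dGz : derivable G z (delta_mx 0 j) by apply: diff_derivable; exact: dg.
  by rewrite deriveB ?deriveZ//; exact: derivableZ.
have dDU j : differentiable ('D_(delta_mx 0 j) U) y.
  by have [h _] := ddu j; exact: h.
have dDG j : differentiable ('D_(delta_mx 0 j) G) y.
  by have [h _] := ddg j; exact: h.
pose p j := 'D_(delta_mx 0 j) U - a *: 'D_(delta_mx 0 j) G.
have dp j : differentiable (p j) y.
  by apply: differentiableB => //; exact: differentiableZ.
have DpE i j : 'D_(delta_mx 0 i) (p j) y =
    'D_(delta_mx 0 i) ('D_(delta_mx 0 j) U) y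
    - a * 'D_(delta_mx 0 i) ('D_(delta_mx 0 j) G) y.
  rewrite deriveB ?deriveZ//; first exact: diff_derivable.
    exact: diff_derivable.
  by apply: derivableZ; exact: diff_derivable.
have dif : differential c u x = a *: differential c gamma x.
  apply/rowP => j; rewrite !mxE /pd -/y -/U -/G; apply/eqP.
  by rewrite -subr_eq0 -DW//; apply/eqP; exact: derive_at_max.
rewrite dif FZ mulrDr lerD2r -/y -/U -/G.
rewrite -subr_le0 /second_order mulr_sumr -sumrB.
pose H := \matrix_(i < m, j < m) 'D_(delta_mx 0 i) (p j) y.
rewrite (_ : \sum_(i < m) _ =
    \sum_(i < m) \sum_(j < m) H i j * principal T c x j i); last first.
  apply: eq_bigr => i _; rewrite mulr_sumr -sumrB.
  by apply: eq_bigr => j _; rewrite [H i j]mxE DpE mulrBl mulrA.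
apply: sum_psdmx_le0; last exact: principal_psdmx.
move=> v; rewrite bilin_sum.
under eq_bigr do under eq_bigr do rewrite mxE.
apply: (@hessian_at_max _ _ W) => //.
by apply: filterS ny => z iz j; exact: DW.
Qed.

End LocalExpression.

(** * Continuity and global maxima by compactness *)

Section Exhaustion.
Context {R : realType} {m : nat} {M : manifold R m}.

Lemma classC_continuous k (f : M -> R) : classC k.+1 f -> continuous f.
Proof.
move=> fC x; have [c ac dx] := atlas_cover x; have [df _] := fC c ac.
have nx : nbhs x (dom c) by apply: open_nbhs_nbhs; split=> //; exact: dom_open.
have cfc : {for x, continuous (f \o param c \o Defs.coord c)}.
  apply: continuous_comp; first exact: Defs.coord_continuous.
  by apply: differentiable_continuous; apply: df; exact: coord_img.
rewrite /prop_for /continuous_at /= coordK// in cfc.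
apply: cvg_trans cfc; apply: near_eq_cvg.
by apply: filterS nx => y dy; rewrite /= coordK.
Qed.

(** The strict inequality puts [x] in [K], so the maximum over [K] is at least [f x] and beats every
    value outside. *)
Lemma exists_global_max (T : topologicalType) (f : T -> R) (x : T)
    (K : set T) : compact K -> continuous f -> (forall y, ~ K y -> f y < f x) ->
  exists y, forall z, f z <= f y.
Proof.
move=> cK cf fK.
have Kx : K x by apply: contrapT => /fK; rewrite ltxx.
have K0 : K !=set0 by exists x.
have [y] := compact_EVT_max K0 cK (continuous_subspaceT cf).
rewrite inE => Ky ymax; exists y => z.
have [Kz|nKz] := pselect (K z); first by apply: ymax; rewrite inE.
by apply: le_trans (ymax x _); [exact/ltW/fK|rewrite inE].
Qed.

End Exhaustion.

(** * The maximum principle, by penalising [u] with [a * gamma] *)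

Theorem theoremA (R : realType) (m : nat) (m_ge2 : (2 <= m)%N)
    (M : manifold R m) (M_nonempty : [set: M] !=set0)
    (M_connected : connected [set: M])
    (g : riemannian_metric M)
    (T : bilinear_field M) (T_sym : symmetric_field T) (T_psd : psd_field T)
    (T_diff : differentiable_field T)
    (X : vector_field M)
    (q : M -> R) (q_cont : continuous q) (q_ge0 : forall x, 0 <= q x)
    (q_gt0 : \forall x \near at_infinity M, 0 < q x)
    (gamma : M -> R) (gamma_C2 : classC 2 gamma)
    (gamma_oo : gamma x @[x --> at_infinity M] --> +oo)
    (B : R) (B_gt0 : 0 < B)
    (gamma_L : \forall x \near at_infinity M,
       q x * operatorL g T X gamma x <= B)
    (u : M -> R) (u_C2 : classC 2 u) (u_bounded : has_ubound (range u)) :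
  exists x_ : nat -> M, forall k : nat, (1 <= k)%N ->
    u (x_ k) > sup (range u) - k%:R^-1 /\
    q (x_ k) * operatorL g T X u (x_ k) < k%:R^-1.
Proof.
have [x0 _] := M_nonempty.
have cu := classC_continuous _ _ u_C2; have cg := classC_continuous _ _ gamma_C2.
have u_sup : has_sup (range u) by split=> //; exists (u x0); exists x0.
have le_sup x : u x <= sup (range u) by apply: sup_upper_bound => //; exists x.
suff h k : (1 <= k)%N -> exists x, u x > sup (range u) - k%:R^-1 /\
    q x * operatorL g T X u x < k%:R^-1.
  have /choice[x_ hx] : forall k, exists x, (1 <= k)%N ->
      u x > sup (range u) - k%:R^-1 /\ q x * operatorL g T X u x < k%:R^-1.
    by move=> [|k]; [exists x0|have [//|x hx] := h k.+1; exists x].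
  by exists x_ => k; exact: hx.
move=> k1; have k0 : 0 < k%:R^-1 :> R by rewrite invr_gt0 ltr0n.
have [[x xsup]|no_max] := pselect (exists x, u x = sup (range u)).
  exists x; split; first by rewrite xsup ltrBlDr ltrDl.
  (* The comparison with [a = 0] is the plain maximum principle. *)
  have Lx : operatorL g T X u x <= 0 * operatorL g T X gamma x.
    apply: operatorL_at_max => // y.
    by rewrite !mul0r !subr0 xsup.
  rewrite mul0r in Lx; apply: le_lt_trans k0.
  by rewrite mulr_ge0_le0.
have lt_sup x : u x < sup (range u).
  by rewrite lt_neqAle le_sup andbT; apply/eqP => e; apply: no_max; exists x.
have far (b : R) : exists2 K, compact K & forall x, ~ K x -> b < gamma x.
  by have [K cK hK] := gamma_oo _ (nbhs_pinfty_gt (num_real b)); exists K.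
(* The minimum of [gamma] makes [gamma - gamma p] a nonnegative penalty. *)
have [p pmin] : exists p, forall x, gamma p <= gamma x.
  have [K cK hK] := far (gamma x0).
  have [||p pmax] := @exists_global_max R M (fun x => - gamma x) x0 K cK.
  - by move=> x; apply: continuousN; exact: cg.
  - by move=> x /hK; rewrite ltrN2.
  - by exists p => x; rewrite -lerN2.
have [K cK hK] := gamma_L.
have [b bsup bK] : exists2 b, b < sup (range u) & forall x, K x -> u x <= b.
  have [[x Kx]|nK] := pselect (K !=set0); last first.
    (* For empty [K], any value of [u] serves as [b]. *)
    exists (u x0) => // x Kx; exfalso; by apply: nK; exists x.
  have K0 : K !=set0 by exists x.
  have [y] := compact_EVT_max K0 cK (continuous_subspaceT cu).
  by move=> _ ymax; exists (u y) => // z Kz; apply: ymax; rewrite inE.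
(* A point where [u] exceeds [l] satisfies a) and lies outside [K]. *)
pose l := Num.max b (sup (range u) - k%:R^-1).
have lsup : l < sup (range u) by rewrite gt_max bsup ltrBlDr ltrDl.
have [_ [y _ <-] ly] : exists2 z, range u z & l < z.
  have := sup_adherent (_ : 0 < sup (range u) - l) u_sup.
  by rewrite subr_gt0 subKr => /(_ lsup).
(* The first bound yields [a * B < k%:R^-1], the second keeps the penalised value at [y] above [l];
   adding 1 makes both strict and the second denominator nonzero. *)
pose a := Num.min (k%:R^-1 / (B + 1)) ((u y - l) / (gamma y - gamma p + 1)).
have den0 : 0 < gamma y - gamma p + 1.
  by rewrite ltr_pwDr// subr_ge0.
have a0 : 0 < a.
  by rewrite lt_min !divr_gt0 ?subr_gt0// ltr_wpDl// ltW.
have aB : a * B < k%:R^-1.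
  have : a * (B + 1) <= k%:R^-1 by rewrite -ler_pdivlMr ?ge_min ?lexx// addr_gt0.
  by apply: lt_le_trans; rewrite ltr_pM2l// ltrDl.
have ay : a * (gamma y - gamma p) < u y - l.
  have : a * (gamma y - gamma p + 1) <= u y - l.
    by rewrite -ler_pdivlMr// ge_min lexx orbT.
  by apply: lt_le_trans; rewrite ltr_pM2l// ltrDl.
have [x xmax] : exists x, forall z, u z - a * gamma z <= u x - a * gamma x.
  (* Above this level of [gamma], the bound on [u] forces the penalised function below its value at
     [y]. *)
  have [K' cK' hK'] := far ((sup (range u) - (u y - a * gamma y)) / a).
  apply: (@exists_global_max R M (fun z => u z - a * gamma z) y K' cK').
    move=> z; apply: cvgB; first exact: cu.
    by apply: cvgM; [exact: cvg_cst|exact: cg].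
  move=> z /hK'; rewrite ltr_pdivrMr// => hz.
  by have := le_sup z; lra.
(* Maximality gives [u x >= u y - a * (gamma y - gamma x)], and [gamma x >= gamma p]. *)
have lx : l < u x.
  have := xmax y; have : a * gamma p <= a * gamma x by rewrite ler_pM2l.
  by move: ay; rewrite mulrBr; lra.
exists x; split; first by move: lx; rewrite gt_max => /andP[].
have nKx : ~ K x.
  by move=> /bK; move: lx; rewrite gt_max => /andP[/lt_le_trans h _] /h; rewrite ltxx.
apply: le_lt_trans aB.
have := operatorL_at_max g T X u gamma a x T_sym T_psd T_diff u_C2 gamma_C2 xmax.
move=> /(ler_wpM2l (q_ge0 x)) /le_trans; apply.
by rewrite mulrCA ler_pM2l//; exact: hK.
Qed.
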